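(* The pure cactus Thompson group $PCV$ is not finitely generated.
   Context: Trees. A rooted binary tree is a single vertex or a finite rooted tree in which every non-leaf vertex has a left child and a right child; its $n$ leaves are numbered $1,\dots,n$ from left to right. A caret is the rooted binary tree with two leaves. Attaching a caret to a leaf means identifying the root of the caret with that leaf. Cactus groups. $J_1=\{1\}$; for $n\ge2$, $J_n$ is generated by $s_{i,j}$ $(1\le i<j\le n)$ with relations $s_{i,j}^2=1$; $s_{i,j}s_{k,l}=s_{k,l}s_{i,j}$ for $i<j<k<l$; $s_{i,j}s_{k,l}=s_{i+j-l,i+j-k}s_{i,j}$ for $i\le k<l\le j$. The homomorphism $\pi_n:J_n\to S_n$ sends $s_{i,j}$ to the permutation $m\mapsto i+j-m$ for $i\le m\le j$, fixing all other $m$. Permutations are composed left to right: $(\sigma\tau)(m)=\tau(\sigma(m))$. The group $CV$. A cactus-tree pair is a triple $(T_+,s,T_-)$ with $T_\pm$ rooted binary trees with the same number $n$ of leaves and $s\in J_n$. For $1\le i\le n$, writing $s=s_{j_1,k_1}\cdots s_{j_l,k_l}$, put $p_1=i$ and let $p_{m+1}$ be the image of $p_m$ under $\pi_n(s_{j_m,k_m})$. Set $s'=s'_1\cdots s'_l\in J_{n+1}$, where $s'_m=s_{j_m,k_m}$ if $k_m<p_m$; $s'_m=s_{p_m,p_m+1}s_{j_m,k_m+1}$ if $j_m\le p_m\le k_m$; $s'_m=s_{j_m+1,k_m+1}$ if $p_m<j_m$. Attaching a caret to leaf $i$ of $T_+$ and to leaf $\pi_n(s)(i)$ of $T_-$ gives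 $T'_+,T'_-$; the triple $(T'_+,s',T'_-)$ is called an expansion of $(T_+,s,T_-)$. $CV$ is the set of cactus-tree pairs modulo the equivalence relation generated by expansions. Product: given two classes, choose representatives $(S_+,s,S_-)$, $(T_+,t,T_-)$ with $S_-=T_+$; the product is the class of $(S_+,st,T_-)$. The identity is the class of $(T,1,T)$ and the inverse of $(T_+,s,T_-)$ is $(T_-,s^{-1},T_+)$. Thompson's group $V$ is defined in the same way from tree pairs $(T_+,\sigma,T_-)$ with $\sigma\in S_n$: an expansion attaches a caret to leaf $i$ of $T_+$ and to leaf $\sigma(i)$ of $T_-$ and replaces $\sigma$ by the induced bijection of leaves (left child matched with left child, right child with right child, all other leaves matched as before). The map $\overline\pi:CV\to V$, $(T_+,s,T_-)\mapsto(T_+,\pi_n(s),T_-)$, is a surjective homomorphism, and $PCV:=\ker\overline\pi$. *)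

(* Defs.v *)
From HB Require Import structures.
From Stdlib Require Import Relation_Operators.
From Stdlib Require Eqdep_dec PeanoNat.
From mathcomp Require Import all_boot all_fingroup.
From mathcomp Require Import boolp.
From mathcomp Require Import zify.

Set Implicit Arguments.
Unset Strict Implicit.
Unset Printing Implicit Defensive.

Local Open Scope nat_scope.
Local Open Scope group_scope.
Local Open Scope quotient_scope.

(* The quotient of [T] by the equivalence relation generated by [R]. *)
Section GeneratedQuotient.
Variables (T : choiceType) (R : T -> T -> Prop).

Definition genrel : rel T := fun x y => `[< clos_refl_sym_trans T R x y >].

Lemma genrel_refl : reflexive genrel.
Proof. by move=> x; apply/asboolP; apply: rst_refl. Qed.

Lemma genrel_sym : symmetric genrel.
Proof.
by move=> x y; apply/asboolP/asboolP => h; apply: rst_sym.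
Qed.

Lemma genrel_trans : transitive genrel.
Proof.
move=> y x z /asboolP xy /asboolP yz; apply/asboolP; exact: rst_trans xy yz.
Qed.

Definition genrel_equiv : equiv_rel T :=
  EquivRel genrel genrel_refl genrel_sym genrel_trans.

Definition quot : Type := {eq_quot genrel_equiv}.

HB.instance Definition _ := Choice.on quot.
HB.instance Definition _ := Quotient.on quot.

Definition qclass (x : T) : quot := \pi_quot x.

Definition qrepr (X : quot) : T := generic_quotient.repr X.

Lemma qclassP x y : qclass x = qclass y <-> clos_refl_sym_trans T R x y.
Proof.
split=> [/eqquotP/asboolP//|h]; by apply/eqquotP/asboolP.
Qed.

Lemma qclass_step x y : R x y -> qclass x = qclass y.
Proof. by move=> h; apply/qclassP; apply: rst_step. Qed.

Lemma qclass_repr (X : quot) : qclass (qrepr X) = X.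
Proof. exact: reprK. Qed.

Lemma qclass_ind (P : quot -> Prop) : (forall x, P (qclass x)) -> forall X, P X.
Proof. by move=> h X; rewrite -(qclass_repr X). Qed.

Definition qlift (U : Type) (f : T -> U) (X : quot) : U := f (qrepr X).

Lemma qliftE (U : Type) (f : T -> U) x :
  (forall y z, R y z -> f y = f z) -> qlift f (qclass x) = f x.
Proof.
move=> hf; have : clos_refl_sym_trans T R (qrepr (qclass x)) x.
  by apply/qclassP; rewrite qclass_repr.
rewrite /qlift; move: (qrepr _) => y; elim=> [z t /hf //|//|z t _ -> //|].
by move=> z t w _ -> _ ->.
Qed.

End GeneratedQuotient.

(* Leaves are numbered from 0: the i-th leaf from the left, counted from 1, is
   the ordinal i - 1. *)
Inductive tree := Leaf | Node of tree & tree.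

HB.instance Definition _ := gen_eqMixin tree.
HB.instance Definition _ := gen_choiceMixin tree.

Fixpoint leaves (T : tree) : nat :=
  if T is Node l r then leaves l + leaves r else 1.

Fixpoint attach (T : tree) (i : nat) : tree :=
  match T with
  | Leaf => Node Leaf Leaf
  | Node l r => if i < leaves l then Node (attach l i) r
                else Node l (attach r (i - leaves l))
  end.

Lemma leaves_gt0 T : 0 < leaves T.
Proof. by elim: T => //= l hl r hr; lia. Qed.

Lemma leaves_attach T i : leaves (attach T i) = (leaves T).+1.
Proof.
elim: T i => //= l hl r hr i; case: ifP => _ /=; rewrite ?hl ?hr; lia.
Qed.

Lemma attachC T i j : i < j -> j < leaves T ->
  attach (attach T i) j.+1 = attach (attach T j) i.
Proof.
elim: T i j => [|l hl r hr] i j ij /=; first lia.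
move=> jT; case: (ltnP j (leaves l)) => jl.
  have il : i < leaves l by lia.
  by rewrite il /= !leaves_attach !ifT ?hl //; lia.
case: (ltnP i (leaves l)) => il /=.
  by rewrite leaves_attach il ifF ?subSS //; lia.
by rewrite !ifF ?subSn ?hr //; lia.
Qed.

Fixpoint subtree (T T' : tree) : bool :=
  match T, T' with
  | Leaf, _ => true
  | Node l r, Node l' r' => subtree l l' && subtree r r'
  | _, _ => false
  end.

Fixpoint jointree (T T' : tree) : tree :=
  match T, T' with
  | Leaf, _ => T'
  | _, Leaf => T
  | Node l r, Node l' r' => Node (jointree l l') (jointree r r')
  end.

Lemma subtree_refl T : subtree T T.
Proof. by elim: T => //= l -> r ->. Qed.

Lemma subtree_joinl T T' : subtree T (jointree T T').
Proof.
by elim: T T' => //= l hl r hr [|l' r'] /=; rewrite ?subtree_refl ?hl ?hr.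
Qed.

Lemma subtree_joinr T T' : subtree T' (jointree T T').
Proof.
elim: T T' => /= [T'|l hl r hr [|l' r'] //=]; first exact: subtree_refl.
by rewrite hl hr.
Qed.

Lemma subtree_leaves T T' : subtree T T' -> leaves T <= leaves T'.
Proof.
elim: T T' => /= [T' _|l hl r hr [|l' r'] //= /andP[/hl ? /hr ?]]; last lia.
exact: leaves_gt0.
Qed.

Lemma subtree_eq T T' : subtree T T' -> leaves T' <= leaves T -> T = T'.
Proof.
elim: T T' => /= [[|l r] // _ /=|l hl r hr [|l' r'] //= /andP[a b] c].
  by have := leaves_gt0 l; have := leaves_gt0 r; lia.
have := subtree_leaves a; have := subtree_leaves b => ? ?.
by congr Node; [apply: hl|apply: hr] => //; lia.
Qed.

Lemma subtree_attach_ex T T' : subtree T T' -> leaves T < leaves T' ->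
  exists2 i, i < leaves T & subtree (attach T i) T'.
Proof.
elim: T T' => /= [[|l r] //= _ _|l hl r hr [|l' r'] //= /andP[a b] c].
  by exists 0.
case: (ltnP (leaves l) (leaves l')) => ll.
  have [i il hi] := hl _ a ll; exists i; first lia.
  by rewrite il /= hi b.
have rr : leaves r < leaves r' by lia.
have [i ir hi] := hr _ b rr; exists (leaves l + i); first lia.
by rewrite ltnNge leq_addr /= addKn a hi.
Qed.

Lemma subtree_attachl T T' i : subtree (attach T i) T' -> subtree T T'.
Proof.
elim: T T' i => //= l hl r hr [|l' r'] i; case: ifP => //= _ /andP[a b].
  by rewrite (hl _ _ a).
by rewrite a (hr _ _ b).
Qed.

Lemma subtree_attach2 T T' i j : i < j -> j < leaves T ->
  subtree (attach T i) T' -> subtree (attach T j) T' ->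
  subtree (attach (attach T j) i) T'.
Proof.
elim: T T' i j => [|l hl r hr] T' i j ij /=; first lia.
move=> jT; case: (ltnP j (leaves l)) => jl.
  have il : i < leaves l by lia.
  case: T' => [|l' r'] //; rewrite !il ?leaves_attach /= ?leaves_attach //.
  rewrite ifT /=; last lia.
  by move=> /andP[a b] /andP[c _]; rewrite (hl l' i j) // b.
case: (ltnP i (leaves l)) => il /=.
  rewrite ?il; case: T' => [|l' r'] //=.
  by move=> /andP[a _] /andP[_ b]; rewrite a b.
rewrite ?ifF ?[attach _ _]/=; [|lia..]; case: T' => [|l' r'] //=.
by move=> /andP[a b] /andP[_ c]; rewrite a hr //; lia.
Qed.

Definition ntree (n : nat) := {T : tree | leaves T == n}.

Lemma ntree_size n m (A : ntree n) (B : ntree m) : val A = val B -> n = m.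
Proof.
move=> h; have hA := eqP (valP A); have hB := eqP (valP B).
by move: hA hB; rewrite h => -> ->.
Qed.

Lemma caret_subproof n (T : ntree n) (i : 'I_n) :
  leaves (attach (val T) i) == n.+1.
Proof. by rewrite leaves_attach (eqP (valP T)). Qed.

Definition caret n (T : ntree n) (i : 'I_n) : ntree n.+1 :=
  exist _ (attach (val T) i) (caret_subproof T i).

(* The ordinal with the same value, which is the number of the left leaf of the
   caret attached to leaf [i]. *)
Definition wid n (i : 'I_n) : 'I_n.+1 := widen_ord (leqnSn n) i.

Lemma lift_wid_neq n (p q : 'I_n) : q != p ->
  (lift (wid p) q = q.+1 :> nat /\ lift (wid q) p = p :> nat /\ p < q) \/
  (lift (wid p) q = q :> nat /\ lift (wid q) p = p.+1 :> nat /\ q < p).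
Proof.
move=> /negbTE; rewrite -val_eqE /= /bump => qp; case: ltngtP qp => //; lia.
Qed.

Lemma caretC n (T : ntree n) (p q : 'I_n) : q != p ->
  caret (caret T p) (lift (wid p) q) = caret (caret T q) (lift (wid q) p).
Proof.
move=> qp; apply: val_inj.
have hT := eqP (valP T); have hp := ltn_ord p; have hq := ltn_ord q.
change (attach (attach (val T) p) (lift (wid p) q : nat) =
        attach (attach (val T) q) (lift (wid q) p : nat)).
by case: (lift_wid_neq qp) => -[-> [-> h]]; rewrite attachC ?hT.
Qed.

(* CV and V are both obtained from a family of groups G_n over S_n by gluing
   triples (T_+, s, T_-), s in G_n, along expansions. [clone i s] is the element
   s' of G_{n+1} occurring in the expansion at leaf i. The laws below are what
   makes the product well defined; [clone_perm] says that [clone i s] matches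
   the two leaves of the caret at i with those of the caret at [to_perm s i]
   in order, and all the other leaves as before. In 'S_n, s * t is s followed
   by t (permM). *)
Record cloning := Cloning {
  carrier :> nat -> groupType;
  to_perm : forall n, carrier n -> 'S_n;
  clone : forall n, 'I_n -> carrier n -> carrier n.+1;
  to_permM : forall n (s t : carrier n),
    to_perm (s * t) = to_perm s * to_perm t;
  cloneM : forall n (i : 'I_n) (s t : carrier n),
    clone i (s * t) = clone i s * clone (to_perm s i) t;
  clone_perm : forall n (i : 'I_n) (s : carrier n),
    to_perm (clone i s) =
      lift_perm (wid i) (wid (to_perm s i)) (to_perm s);
  cloneC : forall n (i j : 'I_n) (s : carrier n), j != i ->
    clone (lift (wid i) j) (clone i s) = clone (lift (wid j) i) (clone j s)
}.

Section CloningTheory.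
Variable D : cloning.

Lemma to_perm1 n : to_perm (1 : D n) = 1.
Proof.
have h := to_permM (1 : D n) 1; rewrite mulg1 in h.
exact: mulgI (etrans (esym h) (esym (mulg1 _))).
Qed.

Lemma to_permV n (s : D n) : to_perm s^-1 = (to_perm s)^-1.
Proof.
have h := to_permM s s^-1; rewrite mulgV to_perm1 in h.
exact: mulgI (etrans (esym h) (esym (mulgV _))).
Qed.

Lemma clone1 n (i : 'I_n) : clone i (1 : D n) = 1.
Proof.
apply: (mulgI (clone i 1)); rewrite mulg1.
by rewrite -[in RHS](mulg1 1) cloneM to_perm1 perm1.
Qed.

Lemma cloneV n (i : 'I_n) (s : D n) :
  clone (to_perm s i) s^-1 = (clone i s)^-1.
Proof. by apply: (mulgI (clone i s)); rewrite -cloneM !mulgV clone1. Qed.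

Record tree_pair := TreePair {
  npair : nat;
  domt : ntree npair;
  elt : D npair;
  codt : ntree npair
}.

HB.instance Definition _ := gen_eqMixin tree_pair.
HB.instance Definition _ := gen_choiceMixin tree_pair.

Definition expand (x : tree_pair) (i : 'I_(npair x)) : tree_pair :=
  TreePair (caret (domt x) i) (clone i (elt x))
           (caret (codt x) (to_perm (elt x) i)).

Definition expansion (x y : tree_pair) : Prop :=
  exists i : 'I_(npair x), y = expand i.

Definition thompson : Type := quot expansion.

HB.instance Definition _ := Choice.on thompson.

Definition tclass (x : tree_pair) : thompson := qclass expansion x.

Definition tcomp (x y z : tree_pair) : Prop :=
  exists n (A B C : ntree n) (s t : D n),
    [/\ x = TreePair A s B, y = TreePair B t C & z = TreePair A (s * t) C].

Definition tinv (x : tree_pair) : tree_pair :=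
  TreePair (codt x) (elt x)^-1 (domt x).

Notation "x ~~> y" := (clos_refl_trans_1n tree_pair expansion x y) (at level 70).
Notation "x === y" := (clos_refl_sym_trans tree_pair expansion x y) (at level 70).

Local Notation dtree x := (val (domt x)).
Local Notation ctree x := (val (codt x)).

Lemma exps_trans x y z : x ~~> y -> y ~~> z -> x ~~> z.
Proof.
by elim=> // a b c ab _ ih /ih; apply: rt1n_trans.
Qed.

Lemma exps_equiv x y : x ~~> y -> x === y.
Proof.
elim=> [a|a b c ab _ ih]; first exact: rst_refl.
by apply: rst_trans ih; apply: rst_step.
Qed.

Lemma exps1 x y : expansion x y -> x ~~> y.
Proof. by move=> h; apply: rt1n_trans h _; apply: rt1n_refl. Qed.

Lemma leaves_dtree x : leaves (dtree x) = npair x.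
Proof. exact: eqP (valP (domt x)). Qed.

Lemma npair_dtree x y : dtree x = dtree y -> npair x = npair y.
Proof.
move=> h.
exact: etrans (esym (leaves_dtree x)) (etrans (congr1 leaves h) (leaves_dtree y)).
Qed.

Lemma tinvK : involutive tinv.
Proof. by case=> n A s B; rewrite /tinv /= invgK. Qed.

Lemma expansion_inv x y : expansion x y -> expansion (tinv x) (tinv y).
Proof.
case: x => n A s B [i ->]; exists (to_perm s i).
by rewrite /tinv /expand /= cloneV to_permV permK.
Qed.

Lemma exps_inv x y : x ~~> y -> tinv x ~~> tinv y.
Proof.
elim=> [a|a b c /expansion_inv ab _ ih]; first exact: rt1n_refl.
exact: rt1n_trans ab ih.
Qed.

Lemma equiv_inv x y : x === y -> tinv x === tinv y.
Proof.
elim=> [a b /expansion_inv ab|a|a b _ ih|a b c _ ab _ bc].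
- exact: rst_step.
- exact: rst_refl.
- exact: rst_sym.
- exact: rst_trans ab bc.
Qed.

Lemma expandC n (A B : ntree n) (s : D n) (i j : 'I_n) : j != i ->
  @expand (@expand (TreePair A s B) i) (lift (wid i) j) =
  @expand (@expand (TreePair A s B) j) (lift (wid j) i).
Proof.
move=> ji.
have sji : to_perm s j != to_perm s i.
  by apply/eqP => /perm_inj e; rewrite e eqxx in ji.
rewrite /expand /= cloneC // (caretC A ji) !clone_perm !lift_perm_lift.
by rewrite (caretC B sji).
Qed.

Lemma expandC_ex x (i j : 'I_(npair x)) : j != i ->
  exists w, [/\ expansion (expand i) w, expansion (expand j) w &
    i < j -> dtree w = attach (attach (dtree x) j) i].
Proof.
case: x i j => n A s B /= i j ji.
exists (@expand (@expand (TreePair A s B) i) (lift (wid i) j)); split.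
- by exists (lift (wid i) j).
- by rewrite expandC //; exists (lift (wid j) i).
move=> ij; rewrite expandC //.
change (attach (attach (val A) j) (lift (wid j) i : nat) =
        attach (attach (val A) j) i).
by case: (lift_wid_neq ji) => -[e [-> h]] //; lia.
Qed.

Lemma exps_strip x y z : expansion x y -> x ~~> z ->
  exists2 w, y ~~> w & z = w \/ expansion z w.
Proof.
move=> xy xz; elim: xz y xy => {x z} [x y xy|x x' z xx' x'z ih y xy].
  by exists y; [apply: rt1n_refl|right].
have [yx|[w [yw x'w]]] : y = x' \/ exists w, expansion y w /\ expansion x' w.
  case: xx' xy => i -> [j ->]; case: (eqVneq j i) => [->|ji]; first by left.
  by right; have [w [? ? _]] := expandC_ex ji; exists w.
- by subst y; exists z; last by left.
- have [v wv zv] := ih w x'w; exists v => //; exact: rt1n_trans yw wv.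
Qed.

Lemma exps_confl x y z : x ~~> y -> x ~~> z -> exists2 w, y ~~> w & z ~~> w.
Proof.
move=> xy; elim: xy z => {x y} [x z xz|x x' y xx' _ ih z xz].
  by exists z => //; apply: rt1n_refl.
have [w x'w zw] := exps_strip xx' xz.
have [v yv wv] := ih w x'w; exists v => //.
by case: zw => [->//|zw]; apply: rt1n_trans zw wv.
Qed.

Lemma equiv_exps x y : x === y -> exists2 w, x ~~> w & y ~~> w.
Proof.
elim=> {x y} [x y xy|x|x y _ [w ? ?]|x y z _ [u xu yu] _ [v yv zv]].
- by exists y; [apply: exps1|apply: rt1n_refl].
- by exists x; apply: rt1n_refl.
- by exists w.
- have [w uw vw] := exps_confl yu yv.
  by exists w; [apply: exps_trans uw|apply: exps_trans vw].
Qed.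

Lemma exps_npair x y : x ~~> y -> npair x <= npair y.
Proof. by elim=> // a b c [i ->] _; apply: leq_trans (leqnSn _). Qed.

Lemma exps_subtree x y : x ~~> y -> subtree (dtree x) (dtree y).
Proof.
elim=> [a|a b c [i ->] _]; first exact: subtree_refl.
exact: subtree_attachl.
Qed.

Lemma exps_dom x S : subtree (dtree x) S -> exists2 y, x ~~> y & dtree y = S.
Proof.
move: {2}(leaves S - npair x) (leqnn (leaves S - npair x)) => k.
elim: k x => [|k ih] x hk hx.
  exists x; first exact: rt1n_refl.
  by apply: subtree_eq => //; rewrite leaves_dtree; lia.
case: (ltnP (npair x) (leaves S)) => hS; last first.
  exists x; first exact: rt1n_refl.
  by apply: subtree_eq => //; rewrite leaves_dtree.
have := subtree_attach_ex hx; rewrite leaves_dtree => /(_ hS) [i ix hi].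
have [|//|y xy <-] := ih (expand (Ordinal ix)).
  by rewrite /=; lia.
exists y => //; apply: rt1n_trans xy; by exists (Ordinal ix).
Qed.

Lemma exps_cod x S : subtree (ctree x) S -> exists2 y, x ~~> y & ctree y = S.
Proof.
move=> /(@exps_dom (tinv x)) [y xy <-]; exists (tinv y) => //.
by rewrite -(tinvK x); apply: exps_inv.
Qed.

Lemma exps_size x y : x ~~> y -> npair y <= npair x -> y = x.
Proof. by case=> // a b [i ->] /exps_npair /= h e; lia. Qed.

Lemma exps_dom_uniq x y z :
  x ~~> y -> x ~~> z -> dtree y = dtree z -> y = z.
Proof.
move: {2}(npair y - npair x) (leqnn (npair y - npair x)) => k.
elim: k x y z => [|k ih] x y z hk xy xz yz;
  have szy : npair z = npair y := esym (npair_dtree yz).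
  by rewrite (exps_size xy) 1?(exps_size xz) //; lia.
case: (leqP (npair y) (npair x)) => hxy.
  by rewrite (exps_size xy) 1?(exps_size xz) //; lia.
have stepE u : x ~~> u -> npair u = npair y ->
    exists i : 'I_(npair x), expand i ~~> u.
  case=> [e|a b [i ->] h _]; [lia|by exists i].
have [i iy] := stepE y xy erefl; have [j jz] := stepE z xz szy.
wlog ij : y z i j hk xy xz yz szy hxy stepE iy jz / i <= j.
  case: (leqP i j) => [ij h|/ltnW ji h]; first exact: (h y z i j).
  have e : npair z = npair y := szy.
  apply: esym; apply: (h z y j i) => //; rewrite ?e //.
have [eij|ji] := eqVneq j i.
  rewrite eij in jz; apply: ih iy jz yz; rewrite /=; lia.
have lij : i < j by rewrite ltn_neqAle ij andbT eq_sym.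
have [w [iw jw /(_ lij) dw]] := expandC_ex ji.
have : subtree (dtree w) (dtree y).
  rewrite dw; apply: subtree_attach2 => //.
  - by rewrite leaves_dtree.
  - exact: exps_subtree iy.
  - rewrite yz; exact: exps_subtree jz.
move=> /exps_dom [v wv vy].
have hv : npair v = npair y := npair_dtree vy.
have -> : y = v.
  apply: (ih _ _ _ _ iy (rt1n_trans _ _ _ _ _ iw wv)) => //.
  by rewrite /=; lia.
apply: (ih _ _ _ _ (rt1n_trans _ _ _ _ _ jw wv) jz).
  by rewrite /=; lia.
by rewrite vy.
Qed.

Lemma exps_cod_uniq x y z :
  x ~~> y -> x ~~> z -> ctree y = ctree z -> y = z.
Proof.
move=> /exps_inv xy /exps_inv xz yz.
by apply: (can_inj tinvK); apply: exps_dom_uniq xy xz yz.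
Qed.

Lemma tcomp_inv u v w : tcomp u v w -> tcomp (tinv v) (tinv u) (tinv w).
Proof.
move=> [n [A [B [C [s [t [-> -> ->]]]]]]]; exists n, C, B, A, t^-1, s^-1.
by rewrite /tinv /= invgM.
Qed.

Lemma tcomp_step u v w u' : tcomp u v w -> expansion u u' ->
  exists v' w', [/\ expansion v v', expansion w w' & tcomp u' v' w'].
Proof.
move=> [n [A [B [C [s [t [-> -> ->]]]]]]] [i ->].
exists (@expand (TreePair B t C) (to_perm s i)).
exists (@expand (TreePair A (s * t) C) i).
split; [by exists (to_perm s i)|by exists i|].
exists n.+1, (caret A i), (caret B (to_perm s i)).
exists (caret C (to_perm t (to_perm s i))), (clone i s).
exists (clone (to_perm s i) t); split=> //.
by rewrite /expand /= cloneM to_permM permM.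
Qed.

Lemma tcomp_exps u v w u' : tcomp u v w -> u ~~> u' ->
  exists v' w', [/\ v ~~> v', w ~~> w' & tcomp u' v' w'].
Proof.
move=> + uu'; elim: uu' v w => {u u'} [u|u a u' ua _ ih] v w h.
  by exists v, w; split=> //; apply: rt1n_refl.
have [v1 [w1 [vv1 ww1 /ih [v' [w' [? ? ?]]]]]] := tcomp_step h ua.
by exists v', w'; split=> //; [apply: rt1n_trans vv1 _|apply: rt1n_trans ww1 _].
Qed.

Lemma tcomp_expsr u v w v' : tcomp u v w -> v ~~> v' ->
  exists u' w', [/\ u ~~> u', w ~~> w' & tcomp u' v' w'].
Proof.
move=> /tcomp_inv h /exps_inv /(tcomp_exps h).
move=> [u' [w' [/exps_inv uu /exps_inv ww /tcomp_inv hc]]].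
by exists (tinv u'), (tinv w'); rewrite !tinvK in uu ww hc.
Qed.

Lemma tcomp_fun u v w w' : tcomp u v w -> tcomp u v w' -> w = w'.
Proof.
have inj n (A A' B B' : ntree n) (s s' : D n) :
    TreePair A s B = TreePair A' s' B' -> [/\ A = A', s = s' & B = B'].
  have inj2 (P : nat -> Type) k (x y : P k) :
      existT P k x = existT P k y -> x = y.
    exact: Eqdep_dec.inj_pair2_eq_dec PeanoNat.Nat.eq_dec _ _ _ _.
  by case=> e1 e2 e3; split; [apply: inj2 e1|apply: inj2 e2|apply: inj2 e3].
move=> [n [A [B [C [s [t [-> -> ->]]]]]]].
move=> [m [A' [B' [C' [s' [t' [e1 e2 ->]]]]]]].
have e : n = m by case: e1.
subst m; by have [-> -> _] := inj _ _ _ _ _ _ _ e1; have [_ -> ->] := inj _ _ _ _ _ _ _ e2.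
Qed.

Lemma tcomp_tree u v w : tcomp u v w -> ctree u = dtree v.
Proof. by move=> [n [A [B [C [s [t [-> -> _]]]]]]]. Qed.

Lemma tcomp_ex u v : ctree u = dtree v -> exists w, tcomp u v w.
Proof.
case: u v => n A s B [m B' t C] /= h.
have e : n = m := ntree_size h.
subst m; have {}h : B = B' by apply: val_inj.
by subst B'; exists (TreePair A (s * t) C), n, A, B, C, s, t.
Qed.

Lemma tcomp_equiv u v w u' v' w' :
  tcomp u v w -> tcomp u' v' w' -> u === u' -> v === v' -> w === w'.
Proof.
move=> h h' /equiv_exps [a ua ua'] vv'.
have [v1 [w1 [vv1 ww1 h1]]] := tcomp_exps h ua.
have [v2 [w2 [vv2 ww2 h2]]] := tcomp_exps h' ua'.
have v12 : v1 === v2.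
  apply: rst_trans (exps_equiv vv2); apply: rst_trans vv'.
  by apply: rst_sym; apply: exps_equiv.
have [b v1b v2b] := equiv_exps v12.
have [a1 [c1 [aa1 wc1 k1]]] := tcomp_expsr h1 v1b.
have [a2 [c2 [aa2 wc2 k2]]] := tcomp_expsr h2 v2b.
have a12 : a1 = a2.
  apply: exps_cod_uniq aa1 aa2 _.
  by rewrite (tcomp_tree k1) (tcomp_tree k2).
rewrite -a12 in k2; have c12 := tcomp_fun k1 k2.
apply: rst_trans (exps_equiv (exps_trans ww1 wc1)) _.
by rewrite c12; apply/rst_sym/exps_equiv/(exps_trans ww2 wc2).
Qed.

Lemma tcomp_exists u v : exists u' v' w',
  [/\ u ~~> u', v ~~> v' & tcomp u' v' w'].
Proof.
have [u' uu' hu] := exps_cod (subtree_joinl (ctree u) (dtree v)).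
have [v' vv' hv] := exps_dom (subtree_joinr (ctree u) (dtree v)).
have [w h] := @tcomp_ex u' v' (etrans hu (esym hv)).
by exists u', v', w.
Qed.

Lemma tclassP x y : tclass x = tclass y <-> x === y.
Proof. exact: qclassP. Qed.

Lemma exps_tclass x y : x ~~> y -> tclass y = tclass x.
Proof. by move=> /exps_equiv h; apply/tclassP/rst_sym. Qed.

Lemma tclass_ind (P : thompson -> Prop) :
  (forall x, P (tclass x)) -> forall X, P X.
Proof. exact: qclass_ind. Qed.

(* Z is the product of X and Y: it is computed on some representatives
   (A, s, B) of X and (B, t, C) of Y. By [tmul_ex] and [tmul_uniq] it exists
   and is unique. *)
Definition tmul_spec (X Y Z : thompson) : Prop :=
  exists x y z, [/\ X = tclass x, Y = tclass y, Z = tclass z & tcomp x y z].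

Lemma tmul_ex X Y : exists Z, tmul_spec X Y Z.
Proof.
elim/tclass_ind: X => u; elim/tclass_ind: Y => v.
have [u' [v' [w [uu vv h]]]] := tcomp_exists u v.
by exists (tclass w), u', v', w; rewrite !(exps_tclass uu, exps_tclass vv).
Qed.

Lemma tmul_uniq X Y Z Z' : tmul_spec X Y Z -> tmul_spec X Y Z' -> Z = Z'.
Proof.
move=> [x [y [z [-> -> -> h]]]] [x' [y' [z' [/tclassP xx /tclassP yy -> h']]]].
by apply/tclassP; apply: tcomp_equiv h h' xx yy.
Qed.

Definition tmul (X Y : thompson) : thompson := projT1 (cid (tmul_ex X Y)).

Lemma tmulP X Y : tmul_spec X Y (tmul X Y).
Proof. exact: projT2 (cid (tmul_ex X Y)). Qed.

Lemma tmulE n (A B C : ntree n) (s t : D n) :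
  tmul (tclass (TreePair A s B)) (tclass (TreePair B t C)) =
  tclass (TreePair A (s * t) C).
Proof.
apply: tmul_uniq (tmulP _ _) _.
exists (TreePair A s B), (TreePair B t C), (TreePair A (s * t) C).
by split=> //; exists n, A, B, C, s, t.
Qed.

Lemma tcomp_mul x y z : tcomp x y z -> tmul (tclass x) (tclass y) = tclass z.
Proof. by move=> [n [A [B [C [s [t [-> -> ->]]]]]]]; apply: tmulE. Qed.

Lemma leaf_subproof : leaves Leaf == 1%N.
Proof. by []. Qed.

Definition leaf : ntree 1 := exist _ Leaf leaf_subproof.

Definition tone : thompson := tclass (TreePair leaf 1 leaf).

Lemma toneE n (A : ntree n) : tclass (TreePair A 1 A) = tone.
Proof.
have [y xy dy] := @exps_dom (TreePair leaf 1 leaf) (val A) isT.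
rewrite /tone -(exps_tclass xy).
have : exists m (B : ntree m), y = TreePair B 1 B.
  have : exists m (B : ntree m), TreePair leaf 1 leaf = TreePair B 1 B.
    by exists 1%N, leaf.
  elim: xy {dy} => // a b c [i ->] _ ih [m [B e]]; apply: ih.
  subst a; exists m.+1, (caret B i).
  by rewrite /expand /= clone1 to_perm1 perm1.
move=> [m [B e]]; move: dy; rewrite e /= => BA.
have emn : m = n := ntree_size BA.
by subst m; have -> : A = B by apply: val_inj.
Qed.

Definition tinvq (X : thompson) : thompson :=
  qlift (fun x => tclass (tinv x)) X.

Lemma tinvqE x : tinvq (tclass x) = tclass (tinv x).
Proof.
rewrite /tinvq qliftE // => y z /expansion_inv h.
exact: qclass_step.
Qed.

Lemma thompson3 X Y Z : exists n (A B C E : ntree n) (s t u : D n),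
  [/\ X = tclass (TreePair A s B), Y = tclass (TreePair B t C)
    & Z = tclass (TreePair C u E)].
Proof.
have [x [y [w [-> -> _ h]]]] := tmulP X Y.
elim/tclass_ind: Z => z.
have [y1 yy1 hy] := exps_cod (subtree_joinl (ctree y) (dtree z)).
have [z' zz' hz] := exps_dom (subtree_joinr (ctree y) (dtree z)).
have [x' [w' [xx' _ h1]]] := tcomp_expsr h yy1.
rewrite -(exps_tclass xx') -(exps_tclass yy1) -(exps_tclass zz').
move: h1 hz hy => [n [A [B [C [s [t [-> -> _]]]]]]] hz hy.
case: z' hz {zz'} => m C' u E /=; rewrite -hy /= => CC.
have e : m = n := ntree_size CC.
subst m; have {}CC : C' = C by apply: val_inj.
by subst C'; exists n, A, B, C, E, s, t, u.
Qed.

Lemma tmulA : associative tmul.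
Proof.
move=> X Y Z.
have [n [A [B [C [E [s [t [u [-> -> ->]]]]]]]]] := thompson3 X Y Z.
by rewrite !tmulE mulgA.
Qed.

Lemma tmul1 : left_id tone tmul.
Proof.
by elim/tclass_ind => -[n A s B]; rewrite -(toneE A) tmulE mul1g.
Qed.

Lemma tmulr1 : right_id tone tmul.
Proof.
by elim/tclass_ind => -[n A s B]; rewrite -(toneE B) tmulE mulg1.
Qed.

Lemma tmulV : left_inverse tone tinvq tmul.
Proof.
by elim/tclass_ind => -[n A s B]; rewrite tinvqE /tinv /= tmulE mulVg toneE.
Qed.

Lemma tmulrV : right_inverse tone tinvq tmul.
Proof.
by elim/tclass_ind => -[n A s B]; rewrite tinvqE /tinv /= tmulE mulgV toneE.
Qed.

HB.instance Definition _ :=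
  isGroup.Build thompson tmulA tmul1 tmulr1 tmulV tmulrV.

End CloningTheory.

Section PermCloning.
Variable n : nat.
Implicit Types (s t : 'S_n) (i j : 'I_n).

(* [lift_perm] sends the left leaf of the caret at i to the left leaf of the
   caret at [s i], and [lift (wid i) k] to [lift (wid (s i)) (s k)]; for k = i
   these are the two right leaves, for k != i the renumbered other leaves. *)
Definition perm_clone i s : 'S_n.+1 := lift_perm (wid i) (wid (s i)) s.

Lemma perm_cloneM i s t :
  perm_clone i (s * t) = perm_clone i s * perm_clone (s i) t.
Proof. by rewrite /perm_clone lift_permM permM. Qed.

End PermCloning.

Lemma lift_lift_wid n (p q : 'I_n) : q != p ->
  lift (wid (lift (wid p) q)) (wid p) = wid (lift (wid q) p).
Proof.
by case/lift_wid_neq => -[e1 [e2 h]]; apply: val_inj;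
  rewrite /= /bump; move: e1 e2; rewrite /= /bump; lia.
Qed.

Lemma lift_lift_lift n (p q : 'I_n) (k : 'I_n) : q != p ->
  lift (wid (lift (wid p) q)) (lift (wid p) k) =
  lift (wid (lift (wid q) p)) (lift (wid q) k).
Proof.
by case/lift_wid_neq => -[e1 [e2 h]]; apply: val_inj;
  rewrite /= /bump; move: e1 e2; rewrite /= /bump; lia.
Qed.

Lemma perm_cloneC n (i j : 'I_n) (s : 'S_n) : j != i ->
  perm_clone (lift (wid i) j) (perm_clone i s) =
  perm_clone (lift (wid j) i) (perm_clone j s).
Proof.
move=> ji; have ij : i != j by rewrite eq_sym.
have sji : s j != s i by apply/eqP => /perm_inj e; rewrite e eqxx in ji.
have sij : s i != s j by rewrite eq_sym.
have pl k l : k != l -> perm_clone k s (lift (wid k) l) = lift (wid (s k)) (s l).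
  by move=> _; rewrite lift_perm_lift.
apply/permP => m; rewrite {1 3}/perm_clone !pl //.
case: (unliftP (wid (lift (wid i) j)) m) => [m1 ->|->]; last first.
  rewrite lift_perm_id -(lift_lift_wid ij) lift_perm_lift lift_perm_id.
  by rewrite -(lift_lift_wid sij).
rewrite lift_perm_lift.
case: (unliftP (wid i) m1) => [m2 ->|->]; last first.
  by rewrite lift_perm_id !lift_lift_wid // lift_perm_id.
by rewrite [in RHS](lift_lift_lift _ ji) !lift_perm_lift (lift_lift_lift _ sji).
Qed.

Definition perm_cloning : cloning :=
  @Cloning (fun n => 'S_n) (fun n s => s) perm_clone
    (fun n s t => erefl) perm_cloneM (fun n i s => erefl) perm_cloneC.

Definition V := thompson perm_cloning.

HB.instance Definition _ := Group.on V.

Section Projection.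
Variable D : cloning.

Definition perm_pair (x : tree_pair D) : tree_pair perm_cloning :=
  @TreePair perm_cloning _ (domt x) (to_perm (elt x)) (codt x).

Definition pibar (X : thompson D) : V := qlift (fun x => tclass (perm_pair x)) X.

Lemma pibarE x : pibar (tclass x) = tclass (perm_pair x).
Proof.
rewrite /pibar qliftE // => y z [i ->]; apply: qclass_step; exists i.
by rewrite /perm_pair /expand /= clone_perm.
Qed.

Lemma pibarM : {morph pibar : x y / x * y}.
Proof.
move=> X Y; have [n [A [B [C [_ [s [t [_ [-> ->  _]]]]]]]]] := thompson3 X Y 1.
rewrite [_ * _]tmulE !pibarE /perm_pair /= to_permM.
by rewrite [in RHS]/mul /= tmulE.
Qed.

Lemma pibar1 : pibar 1 = 1.
Proof.
have h := pibarM 1 1; rewrite mulg1 in h.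
exact: mulgI (etrans (esym h) (esym (mulg1 _))).
Qed.

HB.instance Definition _ := isMultiplicative.Build (thompson D) V pibar pibarM.
HB.instance Definition _ :=
  Multiplicative_isUMagmaMorphism.Build (thompson D) V pibar pibar1.

End Projection.

(* Every generator is an involution, so the group presented by the relations
   below is the monoid presented by them, and its elements are classes of
   words in the s_{i,j}. With 0-based indices, s_{i,j} is (i, j), i < j < n;
   the formulas i + j - m are the same as for 1-based ones. *)

Definition cgen (n : nat) := {a : nat * nat | a.1 < a.2 < n}.

Definition lo n (a : cgen n) : nat := (val a).1.
Definition hi n (a : cgen n) : nat := (val a).2.

Inductive cactus_relator n : seq (cgen n) -> seq (cgen n) -> Prop :=
| Crel_invol a : cactus_relator [:: a; a] [::]
| Crel_disjoint a b : hi a < lo b -> cactus_relator [:: a; b] [:: b; a]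
| Crel_nested a b c : lo a <= lo b -> hi b <= hi a ->
    lo c = lo a + hi a - hi b -> hi c = lo a + hi a - lo b ->
    cactus_relator [:: a; b] [:: c; a].

Definition cactus_step n (u v : seq (cgen n)) : Prop :=
  exists p q l r,
    [/\ cactus_relator l r, u = p ++ l ++ q & v = p ++ r ++ q].

Definition J (n : nat) : Type := quot (@cactus_step n).

HB.instance Definition _ n := Choice.on (J n).

Definition cword n (w : seq (cgen n)) : J n := qclass (@cactus_step n) w.

Section CactusGroup.
Variable n : nat.
Implicit Types (u v w : seq (cgen n)) (a b c : cgen n).

Lemma cgenP a : lo a < hi a < n.
Proof. exact: valP a. Qed.

Lemma cgen_eq a b : lo a = lo b -> hi a = hi b -> a = b.
Proof.
move=> e1 e2; apply: val_inj; rewrite (surjective_pairing (val a)).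
by rewrite (surjective_pairing (val b)) -/(lo a) -/(hi a) e1 e2.
Qed.

Lemma cword_relator u v : cactus_relator u v -> cword u = cword v.
Proof.
by move=> h; apply: qclass_step; exists [::], [::], u, v; rewrite !cats0.
Qed.

Lemma cword_cat_eq u v u' v' :
  cword u = cword u' -> cword v = cword v' -> cword (u ++ v) = cword (u' ++ v').
Proof.
move=> /qclassP uu /qclassP vv; apply: (@etrans _ _ (cword (u' ++ v))).
  elim: uu => // [x y [p [q [l [r [h -> ->]]]]]|x y z _ -> _ -> //].
  by apply: qclass_step; exists p, (q ++ v), l, r; rewrite -!catA.
elim: vv => // [x y [p [q [l [r [h -> ->]]]]]|x y z _ -> _ -> //].
by apply: qclass_step; exists (u' ++ p), q, l, r; rewrite -!catA.
Qed.

Lemma cword_rev_eq u v : cword u = cword v -> cword (rev u) = cword (rev v).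
Proof.
move=> /qclassP; elim=> // [x y|x y z _ -> _ -> //].
move=> [p [q [l [r [h -> ->]]]]]; rewrite !rev_cat.
do !apply: cword_cat_eq => //; case: h => {l r}.
- by move=> a; apply: cword_relator; constructor.
- by move=> a b ab; apply/esym/cword_relator; constructor.
- move=> a b c ab ba lc hc; apply/esym/cword_relator.
  have := cgenP a; have := cgenP b; have := cgenP c.
  by move=> *; constructor; lia.
Qed.

Definition cmul (X Y : J n) : J n := cword (qrepr X ++ qrepr Y).

Definition cinv (X : J n) : J n := cword (rev (qrepr X)).

Lemma J_ind (P : J n -> Prop) : (forall w, P (cword w)) -> forall X, P X.
Proof. exact: qclass_ind. Qed.

Lemma cmulE u v : cmul (cword u) (cword v) = cword (u ++ v).
Proof. by apply: cword_cat_eq; apply: qclass_repr. Qed.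

Lemma cinvE u : cinv (cword u) = cword (rev u).
Proof. by apply: cword_rev_eq; apply: qclass_repr. Qed.

Lemma cmulA : associative cmul.
Proof.
elim/J_ind => u; elim/J_ind => v; elim/J_ind => w.
by rewrite !cmulE catA.
Qed.

Lemma cmul1 : left_id (cword [::]) cmul.
Proof. by elim/J_ind => u; rewrite cmulE. Qed.

Lemma cmulr1 : right_id (cword [::]) cmul.
Proof. by elim/J_ind => u; rewrite cmulE cats0. Qed.

Lemma cword_revK w : cword (rev w ++ w) = cword [::].
Proof.
elim: w => //= a w ih; rewrite rev_cons -cats1 -catA /= -[a :: a :: w]cat1s.
rewrite -[[:: a] ++ _]/([:: a; a] ++ w) -{}ih; apply: cword_cat_eq => //.
rewrite -[RHS]/(cword ([::] ++ w)); apply: cword_cat_eq => //.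
by apply: cword_relator; constructor.
Qed.

Lemma cmulV : left_inverse (cword [::]) cinv cmul.
Proof. by elim/J_ind => u; rewrite cinvE cmulE cword_revK. Qed.

Lemma cmulrV : right_inverse (cword [::]) cinv cmul.
Proof.
by elim/J_ind => u; rewrite cinvE cmulE -{1}(revK u) cword_revK.
Qed.

HB.instance Definition _ :=
  isGroup.Build (J n) cmulA cmul1 cmulr1 cmulV cmulrV.

Lemma cwordM u v : cword (u ++ v) = cword u * cword v.
Proof. by rewrite [RHS]cmulE. Qed.

Lemma J_eq_ind (T : Type) (f : seq (cgen n) -> T) :
  (forall p q l r, cactus_relator l r -> f (p ++ l ++ q) = f (p ++ r ++ q)) ->
  forall w, qlift f (cword w) = f w.
Proof.
by move=> h w; apply: qliftE => y z [p [q [l [r [? -> ->]]]]]; apply: h.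
Qed.

(* [gen_perm] is the permutation of s_{i,j}, and [flip] its action on nat. *)
Definition flip (a : cgen n) (m : nat) : nat :=
  if lo a <= m <= hi a then lo a + hi a - m else m.

Lemma flip_subproof a (m : 'I_n) : flip a m < n.
Proof.
by have := cgenP a; have := ltn_ord m; rewrite /flip; case: ifP; lia.
Qed.

Definition flip_ord a (m : 'I_n) : 'I_n := Ordinal (flip_subproof a m).

Lemma flip_inj a : injective (flip_ord a).
Proof.
move=> m k /(congr1 val) /= h; apply: val_inj; move: h.
by rewrite /= /flip; case: ifP; case: ifP; lia.
Qed.

Definition gen_perm a : 'S_n := perm (@flip_inj a).

Definition word_perm w : 'S_n := \prod_(a <- w) gen_perm a.

Lemma gen_permE a m : gen_perm a m = flip a m :> nat.
Proof. by rewrite permE. Qed.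

Lemma word_perm_cat u v : word_perm (u ++ v) = word_perm u * word_perm v.
Proof. by rewrite /word_perm big_cat. Qed.

Lemma word_perm_cons a w : word_perm (a :: w) = gen_perm a * word_perm w.
Proof. by rewrite /word_perm big_cons. Qed.

Lemma word_perm0 : word_perm [::] = 1.
Proof. by rewrite /word_perm big_nil. Qed.

Definition word_permE := (word_perm_cons, word_perm0, permM, perm1).

Lemma word_perm_relator u v : cactus_relator u v -> word_perm u = word_perm v.
Proof.
case=> [a|a b ab|a b c ab ba lc hc]; apply/permP => m; apply: val_inj;
  rewrite !word_permE /= !gen_permE.
- by rewrite /flip; case: ifP; case: ifP; lia.
- have := cgenP a; have := cgenP b.
  by rewrite /flip; do !case: ifP; lia.
- have := cgenP a; have := cgenP b; have := cgenP c.
  by rewrite /flip lc hc; do !case: ifP; lia.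
Qed.

Definition cactus_perm (s : J n) : 'S_n := qlift word_perm s.

Lemma cactus_permE w : cactus_perm (cword w) = word_perm w.
Proof.
apply: J_eq_ind => p q l r /word_perm_relator h.
by rewrite !word_perm_cat h.
Qed.

Lemma cactus_permM s t :
  cactus_perm (s * t) = cactus_perm s * cactus_perm t.
Proof.
elim/J_ind: s => u; elim/J_ind: t => v.
by rewrite -cwordM !cactus_permE word_perm_cat.
Qed.

End CactusGroup.

Section CactusClone.
Variable n : nat.
Implicit Types (u v w : seq (cgen n)) (a b c : cgen n) (p : 'I_n).

Lemma gen_keep_subproof a : lo a < hi a < n.+1.
Proof. by have := cgenP a; lia. Qed.

Lemma gen_shift_subproof a : (lo a).+1 < (hi a).+1 < n.+1.
Proof. by have := cgenP a; lia. Qed.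

Lemma gen_grow_subproof a : lo a < (hi a).+1 < n.+1.
Proof. by have := cgenP a; lia. Qed.

Lemma gen_split_subproof p : p < p.+1 < n.+1.
Proof. by have := ltn_ord p; lia. Qed.

Definition gen_keep a : cgen n.+1 :=
  exist _ (lo a, hi a) (gen_keep_subproof a).
Definition gen_shift a : cgen n.+1 :=
  exist _ ((lo a).+1, (hi a).+1) (gen_shift_subproof a).
Definition gen_grow a : cgen n.+1 :=
  exist _ (lo a, (hi a).+1) (gen_grow_subproof a).
Definition gen_split p : cgen n.+1 :=
  exist _ (p : nat, p.+1) (gen_split_subproof p).

Definition gen_clone p a : seq (cgen n.+1) :=
  if hi a < p then [:: gen_keep a]
  else if p < lo a then [:: gen_shift a]
  else [:: gen_split p; gen_grow a].

Fixpoint word_clone p w : seq (cgen n.+1) :=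
  if w is a :: w' then gen_clone p a ++ word_clone (gen_perm a p) w' else [::].

Lemma word_clone_cat p u v :
  word_clone p (u ++ v) = word_clone p u ++ word_clone (word_perm u p) v.
Proof.
elim: u p => [|a u ih] p /=; first by rewrite word_perm0 perm1.
by rewrite ih catA word_perm_cons permM.
Qed.

Lemma word_clone_perm p w :
  word_perm (word_clone p w) =
    lift_perm (wid p) (wid (word_perm w p)) (word_perm w).
Proof.
elim: w p => [|a w ih] p /=.
  by rewrite !word_perm0 perm1 lift_perm1.
rewrite word_perm_cat ih word_perm_cons permM.
rewrite -(lift_permM _ (wid (gen_perm a p))); congr (_ * _).
apply/permP => m; apply: ord_inj.
have := cgenP a; have := ltn_ord p; have := ltn_ord m => hm hp ha.
have -> : word_perm (gen_clone p a) m =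
    (if hi a < p then flip (gen_keep a) m else
     if p < lo a then flip (gen_shift a) m
     else flip (gen_grow a) (flip (gen_split p) m)) :> nat.
  by rewrite /gen_clone; case: ifP => _; last case: ifP => _;
    rewrite !word_permE !gen_permE.
case: (unliftP (wid p) m) hm => [k ->|->] hm; last first.
  rewrite lift_perm_id /= gen_permE /flip /gen_keep /gen_shift /gen_grow
    /gen_split /lo /hi /=.
  by move: ha; rewrite /lo /hi; do !case: ifP; lia.
rewrite lift_perm_lift /= /bump /= !gen_permE.
have hk := ltn_ord k.
rewrite /flip /gen_keep /gen_shift /gen_grow /gen_split /lo /hi /=.
by move: ha; rewrite /lo /hi; do !case: ifP; lia.
Qed.

End CactusClone.

(* s_{i,j} as a total function of i and j, extended by 1. *)
Definition sg n (i j : nat) : J n :=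
  if insub (i, j) is Some a then cword [:: (a : cgen n)] else 1.

Section StandardGenerators.
Variable n : nat.

Lemma sgE (a : cgen n) : cword [:: a] = sg n (lo a) (hi a).
Proof. by rewrite /sg /lo /hi -surjective_pairing valK. Qed.

Lemma sg_gen i j : i < j < n ->
  exists a : cgen n, [/\ lo a = i, hi a = j & sg n i j = cword [:: a]].
Proof.
by move=> h; exists (exist _ (i, j) h); split=> //; rewrite sgE.
Qed.

Lemma sg_out i j : ~~ (i < j < n) -> sg n i j = 1.
Proof. by move=> h; rewrite /sg insubF //=; apply/negbTE. Qed.

Lemma sgK i j : sg n i j * sg n i j = 1.
Proof.
have [/sg_gen[a [_ _ ->]]|/sg_out->] := boolP (i < j < n); last exact: mulg1.
by rewrite -cwordM; apply: cword_relator; constructor.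
Qed.

Lemma sgKl i j x : sg n i j * (sg n i j * x) = x.
Proof. by rewrite mulgA sgK mul1g. Qed.

Lemma sg_disj i j k l : j < k -> sg n i j * sg n k l = sg n k l * sg n i j.
Proof.
move=> jk.
have [/sg_gen[a [_ ea ->]]|/sg_out->] := boolP (i < j < n); last first.
  by rewrite mulg1 mul1g.
have [/sg_gen[b [eb _ ->]]|/sg_out->] := boolP (k < l < n); last first.
  by rewrite mulg1 mul1g.
by rewrite -!cwordM; apply: cword_relator; constructor; rewrite ea eb.
Qed.

Lemma sg_nest i j k l k' l' : i < j < n -> i <= k -> k < l -> l <= j ->
  k' = i + j - l -> l' = i + j - k ->
  sg n i j * sg n k l = sg n k' l' * sg n i j.
Proof.
move=> ij ik kl lj -> ->.
have [a [la ha ->]] := sg_gen ij.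
have [|b [lb hb ->]] := @sg_gen k l; first lia.
have [|c [lc hc ->]] := @sg_gen (i + j - l) (i + j - k); first lia.
by rewrite -!cwordM; apply: cword_relator; constructor; rewrite ?la ?ha; lia.
Qed.

Lemma sg_nestl i j k l k' l' x : i < j < n -> i <= k -> k < l -> l <= j ->
  k' = i + j - l -> l' = i + j - k ->
  sg n i j * (sg n k l * x) = sg n k' l' * (sg n i j * x).
Proof. by move=> *; rewrite mulgA (@sg_nest _ _ _ _ k' l') // mulgA. Qed.

End StandardGenerators.

Section ClonedGenerators.
Variable n : nat.

Definition sclone i j p : J n.+1 :=
  if j < p then sg n.+1 i j
  else if p < i then sg n.+1 i.+1 j.+1
  else sg n.+1 p p.+1 * sg n.+1 i j.+1.

Lemma gen_cloneE p (a : cgen n) :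
  cword (gen_clone p a) = sclone (lo a) (hi a) p.
Proof.
rewrite /gen_clone /sclone; case: ifP => _; first by rewrite sgE.
case: ifP => _; first by rewrite sgE.
by rewrite -[[:: gen_split p; _]]/([:: gen_split p] ++ [:: gen_grow a]) cwordM !sgE.
Qed.

Lemma sclone_lo i j p : j < p -> sclone i j p = sg n.+1 i j.
Proof. by rewrite /sclone => ->. Qed.

Lemma sclone_hi i j p : p < i -> i < j -> sclone i j p = sg n.+1 i.+1 j.+1.
Proof. by move=> pi ij; rewrite /sclone ifF ?pi //; lia. Qed.

Lemma sclone_mid i j p : i <= p <= j ->
  sclone i j p = sg n.+1 p p.+1 * sg n.+1 i j.+1.
Proof. by move=> pi; rewrite /sclone !ifF //; lia. Qed.

End ClonedGenerators.

Definition nflip i j m := if i <= m <= j then i + j - m else m.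

Lemma nflip_in i j m : i <= m <= j -> nflip i j m = i + j - m.
Proof. by rewrite /nflip => ->. Qed.

Lemma nflip_out i j m : ~~ (i <= m <= j) -> nflip i j m = m.
Proof. by rewrite /nflip => /negbTE ->. Qed.

Section CactusClone2.
Variable n : nat.
Implicit Types (u v w : seq (cgen n)) (a b c : cgen n) (p : 'I_n).

Lemma sclone_invol i j (p : nat) : i < j < n -> p < n ->
  sclone n i j p * sclone n i j (nflip i j p) = 1.
Proof.
move=> ij hp; have [jp|pj] := ltnP j p.
  by rewrite nflip_out ?sclone_lo ?sgK //; lia.
have [pi|ip] := ltnP p i.
  by rewrite nflip_out ?sclone_hi ?sgK //; lia.
rewrite nflip_in; last lia.
rewrite !sclone_mid -?mulgA; try lia.
by rewrite (@sg_nestl _ i j.+1 _ _ p p.+1) ?sgKl ?sgK //; lia.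
Qed.

Lemma sclone_disj i j k l (p : nat) :
  i < j -> j < k -> k < l < n -> p < n ->
  sclone n i j p * sclone n k l (nflip i j p) =
  sclone n k l p * sclone n i j (nflip k l p).
Proof.
move=> ij jk kl hp.
have [pj|jp] := leqP p j; last first.
  rewrite (@nflip_out i j) ?(@sclone_lo _ i j); try lia; last first.
    by rewrite /nflip; case: ifP; lia.
  have [lp|pl] := ltnP l p; first by rewrite sclone_lo // sg_disj.
  have [pk|kp] := ltnP p k.
    by rewrite sclone_hi; [apply: sg_disj; lia|lia|lia].
  rewrite sclone_mid; last lia.
  by rewrite mulgA (@sg_disj _ i j p) // -!mulgA (@sg_disj _ i j k).
rewrite (@nflip_out k l); last lia.
rewrite !(@sclone_hi _ k l); try lia; last by rewrite /nflip; case: ifP; lia.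
have [pi|ip] := ltnP p i; first by rewrite sclone_hi; [apply: sg_disj; lia|lia|lia].
rewrite sclone_mid; last lia.
by rewrite -mulgA (@sg_disj _ i j.+1 k.+1) // !mulgA (@sg_disj _ p p.+1 k.+1) //; lia.
Qed.

Lemma sclone_nest i j k l (p : nat) :
  i < j < n -> i <= k -> k < l -> l <= j -> p < n ->
  sclone n i j p * sclone n k l (nflip i j p) =
  sclone n (i + j - l) (i + j - k) p *
  sclone n i j (nflip (i + j - l) (i + j - k) p).
Proof.
move=> ij ik kl lj hp.
set k' := i + j - l; set l' := i + j - k.
have ek' : k' + l = i + j by rewrite /k'; lia.
have el' : l' + k = i + j by rewrite /l'; lia.
clearbody k' l'.
have [jp|pj] := ltnP j p.
  rewrite !nflip_out ?sclone_lo; try lia.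
  by apply: sg_nest; lia.
have [pi|ip] := ltnP p i.
  rewrite !nflip_out ?sclone_hi; try lia.
  by apply: sg_nest; lia.
rewrite (@nflip_in i j); last lia.
rewrite [sclone n i j p]sclone_mid; last lia.
have [pk|kp] := ltnP p k'.
  rewrite nflip_out; last lia.
  rewrite sclone_lo; last lia.
  rewrite sclone_hi; try lia.
  rewrite sclone_mid -?mulgA; last lia.
  rewrite (@sg_nest _ i j.+1 k l k'.+1 l'.+1); try lia.
  by rewrite !mulgA; congr (_ * _); apply: sg_disj; lia.
have [lp|pl] := ltnP l' p.
  rewrite nflip_out; last lia.
  rewrite sclone_hi; try lia.
  rewrite sclone_lo; last lia.
  rewrite sclone_mid -?mulgA; last lia.
  rewrite (@sg_nest _ i j.+1 k.+1 l.+1 k' l'); try lia.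
  by rewrite !mulgA; congr (_ * _); apply/esym/sg_disj; lia.
rewrite nflip_in; last lia.
rewrite !sclone_mid -?mulgA; try lia.
rewrite (@sg_nestl _ i j.+1 _ _ p p.+1) ?sgKl; try lia.
rewrite (@sg_nestl _ k' l'.+1 _ _ p p.+1) ?sgKl; try lia.
by apply: sg_nest; lia.
Qed.

Lemma word_clone_relator p u v : cactus_relator u v ->
  cword (word_clone p u) = cword (word_clone p v).
Proof.
have hp := ltn_ord p.
case=> [a|a b ab|a b c ab ba lc hc];
  rewrite /= ?cats0 ?cwordM !gen_cloneE !gen_permE.
- exact: sclone_invol (cgenP a) hp.
- by apply: sclone_disj => //; have := cgenP a; have := cgenP b; lia.
- rewrite -!/(nflip _ _ _) /flip -!/(nflip _ _ _) lc hc.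
  by apply: sclone_nest => //; have := cgenP a; have := cgenP b; lia.
Qed.

Lemma cword_cons a w : cword (a :: w) = cword [:: a] * cword w.
Proof. exact: (cwordM [:: a]). Qed.

(* By [cactus_cloneE] the word chosen to represent [s] is irrelevant. *)
Definition cactus_clone p (s : J n) : J n.+1 :=
  qlift (fun w => cword (word_clone p w)) s.

Lemma cactus_cloneE p w : cactus_clone p (cword w) = cword (word_clone p w).
Proof.
apply: J_eq_ind => u v l r h; rewrite !word_clone_cat !cwordM.
by rewrite (word_clone_relator _ h) (word_perm_relator h).
Qed.

Lemma cactus_cloneM p (s t : J n) :
  cactus_clone p (s * t) = cactus_clone p s * cactus_clone (cactus_perm s p) t.
Proof.
elim/J_ind: s => u; elim/J_ind: t => v.
by rewrite -cwordM !cactus_cloneE word_clone_cat cwordM cactus_permE.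
Qed.

Lemma cactus_clone_perm p (s : J n) :
  cactus_perm (cactus_clone p s) =
    lift_perm (wid p) (wid (cactus_perm s p)) (cactus_perm s).
Proof.
by elim/J_ind: s => w; rewrite cactus_cloneE !cactus_permE word_clone_perm.
Qed.

Lemma cactus_clone1 p : cactus_clone p 1 = 1.
Proof. exact: (cactus_cloneE p [::]). Qed.

Lemma cactus_clone_sg p i j : i < j < n ->
  cactus_clone p (sg n i j) = sclone n i j p.
Proof.
by case/sg_gen=> a [<- <- ->]; rewrite cactus_cloneE /= cats0 gen_cloneE.
Qed.

Lemma cactus_perm_sg p i j : i < j < n ->
  cactus_perm (sg n i j) p = nflip i j p :> nat.
Proof.
by case/sg_gen=> a [<- <- ->]; rewrite cactus_permE !word_permE gen_permE.
Qed.

End CactusClone2.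

Section CactusCloneC.
Variable n : nat.

Lemma clone_sg2 (q : 'I_n.+1) i j k l : i < j < n.+1 -> k < l < n.+1 ->
  cactus_clone q (sg n.+1 i j * sg n.+1 k l) =
  sclone n.+1 i j q * sclone n.+1 k l (nflip i j q).
Proof.
by move=> ij kl; rewrite cactus_cloneM !cactus_clone_sg // cactus_perm_sg.
Qed.

Lemma cactus_cloneC_gen (p q : 'I_n) (p1 q1 : 'I_n.+1) (a : cgen n) :
  p < q -> p1 = p :> nat -> q1 = q.+1 :> nat ->
  cactus_clone q1 (cactus_clone p (cword [:: a])) =
  cactus_clone p1 (cactus_clone q (cword [:: a])).
Proof.
move=> pq ep eq; have := cgenP a; have hp := ltn_ord p; have hq := ltn_ord q.
rewrite sgE; move: (lo a) (hi a) => i j ij; rewrite !cactus_clone_sg //.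
have [jp|pj] := ltnP j p.
  by rewrite !sclone_lo ?cactus_clone_sg ?sclone_lo //; lia.
have [qi|iq] := ltnP q i.
  by rewrite !sclone_hi ?cactus_clone_sg ?sclone_hi //; lia.
have [pi|ip] := ltnP p i.
  rewrite (sclone_hi _ pi); last lia.
  have [jq|qj] := ltnP j q.
    rewrite (sclone_lo _ _ jq) !cactus_clone_sg; try lia.
    by rewrite sclone_lo ?sclone_hi //; lia.
  rewrite (@sclone_mid _ i j q) ?clone_sg2 ?cactus_clone_sg; try lia.
  rewrite nflip_out ?(@sclone_mid _ i.+1) ?(@sclone_hi _ q) ?(@sclone_hi _ i); try lia.
  by rewrite eq.
rewrite (@sclone_mid _ i j p) ?clone_sg2; try lia.
rewrite (@sclone_lo _ p) ?nflip_out; try lia.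
have [jq|qj] := ltnP j q.
  rewrite (sclone_lo _ _ jq) !cactus_clone_sg; try lia.
  by rewrite sclone_lo ?sclone_mid ?ep //; lia.
rewrite (@sclone_mid _ i j q) ?clone_sg2; try lia.
rewrite nflip_out ?(@sclone_hi _ q) ?sclone_mid; try lia.
rewrite ep eq !mulgA; congr (_ * _).
by apply: sg_disj.
Qed.

Lemma cactus_cloneC_gen2 (p q : 'I_n) (a : cgen n) : q != p ->
  cactus_clone (lift (wid p) q) (cactus_clone p (cword [:: a])) =
  cactus_clone (lift (wid q) p) (cactus_clone q (cword [:: a])).
Proof.
case/lift_wid_neq => -[e1 [e2 h]]; first exact: cactus_cloneC_gen.
by apply/esym/cactus_cloneC_gen.
Qed.

Lemma cactus_cloneC (p q : 'I_n) (s : J n) : q != p ->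
  cactus_clone (lift (wid p) q) (cactus_clone p s) =
  cactus_clone (lift (wid q) p) (cactus_clone q s).
Proof.
elim/J_ind: s => w; elim: w p q => [|a w ih] p q qp.
  by rewrite !cactus_clone1.
rewrite cword_cons !(cactus_cloneM _ (cword [:: a])) !cactus_cloneM.
rewrite cactus_cloneC_gen2 //; congr (_ * _).
rewrite !cactus_clone_perm !lift_perm_lift; apply: ih.
by apply/eqP => /perm_inj e; rewrite e eqxx in qp.
Qed.

End CactusCloneC.

Definition cactus_cloning : cloning :=
  @Cloning J cactus_perm cactus_clone cactus_permM cactus_cloneM
    cactus_clone_perm cactus_cloneC.

Definition CV : groupType := thompson cactus_cloning.

Definition PCV : {pred CV} := [pred x | pibar x == 1].

Lemma PCV_group_closed : group_closed PCV.
Proof.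
split=> [|x y]; rewrite !inE ?gmulf1 // => /eqP hx /eqP hy.
by rewrite gmulfF /= hx hy mulgV.
Qed.

(* The subgroup generated by [S]. *)
Inductive generated (G : groupType) (S : seq G) : G -> Prop :=
| generated_mem x : x \in S -> generated S x
| generated1 : generated S 1
| generatedM x y : generated S x -> generated S y -> generated S (x * y)
| generatedV x : generated S x -> generated S x^-1.

(* Finite generation of a subgroup [H] of [G]. *)
Definition finitely_generated (G : groupType) (H : {pred G}) : Prop :=
  exists S : seq G, forall x, x \in H <-> generated S x.

(* Main.v *)
From Stdlib Require Import Relation_Operators.
From mathcomp Require Import all_boot all_fingroup zify.
From mathcomp Require Import boolp.
Require Import Defs.

Set Implicit Arguments.
Unset Strict Implicit.
Unset Printing Implicit Defensive.

Local Open Scope nat_scope.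
Local Open Scope group_scope.

Local Notation "x ~~> y" := (clos_refl_trans_1n _ (@expansion _) x y)
  (at level 70).

(** A pure class is represented by a pair with twice the same tree T and a pure
    cactus element, and representatives over T give representatives over every
    tree that contains T. So finitely many pure classes, together with the
    subgroup that they generate, live over one single tree T, which may be
    taken with at least two leaves ([generated_pure_over], [pure_over_seq]).
    It remains to find, for each such T, a pure class that is not represented
    over T.

    The obstruction is the homomorphism from the cactus group to
    (Z/2)^{subsets} extended by S_n which sends s_{i,j} to the basis vector of
    the interval {i,...,j} times its permutation. In other words, follow the
    positions of a set S of strands along a word, and count modulo 2 the
    letters s_{i,j} that are met when S occupies exactly the interval from i
    to j. This parity, [odd_flips], does not depend on the word. Cloning the
    strand p acts on it in a simple way:
    - if S has at least two strands, the parity of S is that of the set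
      obtained by doubling p in S ([odd_flips_clone]);
    - the parity of a set that contains exactly one of the two copies of p is
      0 ([odd_flips_clone_split]), because each letter of a cloned word has
      both copies in its interval, or neither.

    By the first property a nonzero parity on a set with at least two elements
    survives all expansions, and so it witnesses that a class is nontrivial.
    Let T' be T with a caret attached to its first leaf. With at least three
    strands, s = (s_{1,3} s_{1,2})^3 is pure and flips {2,3} once. The set
    {2,3} separates the copies 1, 2 of the first leaf of T, so if (T', s, T')
    were equivalent to some (T, t, T), then s times the inverse of the clone
    of t would have parity 1 on {2,3}, while the class of
    (T', s clone(t)^-1, T') would be trivial. *)

(** * Parity of the flips of a set of strands *)

Section OddFlips.
Variable n : nat.
Implicit Types (a b c : cgen n) (u v w : seq (cgen n)) (S : {set 'I_n}).

Definition block a : {set 'I_n} := [set m : 'I_n | lo a <= m <= hi a].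

(** [S] is the set of the current positions of the strands that are followed;
    it moves along with each letter. *)
Fixpoint word_odd_flips w S : bool :=
  if w is a :: w' then (S == block a) (+) word_odd_flips w' (gen_perm a @: S)
  else false.

Lemma word_odd_flips_cat u v S :
  word_odd_flips (u ++ v) S =
    word_odd_flips u S (+) word_odd_flips v (word_perm u @: S).
Proof.
elim: u S => [|a u ih] S /=.
  rewrite word_perm0; congr (word_odd_flips v _).
  by apply/setP => m; rewrite -preim_permV inE invg1 perm1.
rewrite ih addbA word_perm_cons -imset_comp; congr (_ (+) word_odd_flips v _).
by apply: eq_imset => m; rewrite /= permM.
Qed.

Lemma gen_permK a : involutive (gen_perm a).
Proof.
move=> m; apply: ord_inj; rewrite !gen_permE /flip.
by have := cgenP a; do !case: ifP; lia.
Qed.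

Lemma mem_gen_perm a S m : (m \in gen_perm a @: S) = (gen_perm a m \in S).
Proof. by rewrite -[m in LHS](gen_permK a) mem_imset //; apply: perm_inj. Qed.

(** Both sides of a cactus relation have letters with corresponding intervals:
    this is the form in which that correspondence enters the parity. *)
Lemma gen_perm_block a b c :
  (forall m : 'I_n, (lo b <= flip a m <= hi b) = (lo c <= m <= hi c)) ->
  forall S, (gen_perm a @: S == block b) = (S == block c).
Proof.
move=> h S; have inj : injective (fun A : {set _} => gen_perm a @: A).
  apply: (can_inj (g := fun A : {set _} => gen_perm a @: A)) => A.
  by apply/setP => m; rewrite !mem_gen_perm gen_permK.
rewrite -(inj_eq inj S); congr (_ == _); apply/setP => m.
rewrite mem_gen_perm !inE -h gen_permE.
by rewrite -[in LHS](gen_permK a m) !gen_permE.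
Qed.

(** The crucial case is s_a s_b = s_c s_a with b nested in a: S occupies the
    interval of b after the flip a exactly when it occupies that of c before,
    and it occupies the interval of a before or after the flip c alike. *)
Lemma word_odd_flips_relator u v S : cactus_relator u v ->
  word_odd_flips u S = word_odd_flips v S.
Proof.
case=> [a|a b ab|a b c ab ba lc hc] /=; rewrite !addbF.
- rewrite (@gen_perm_block a a a) ?addbb // => m; have := cgenP a.
  by rewrite /flip; case: ifP; lia.
- have := cgenP a; have := cgenP b => hb ha.
  rewrite (@gen_perm_block a b b) ?(@gen_perm_block b a a) 1?addbC // => m;
  by rewrite /flip; case: ifP; lia.
- have := cgenP a; have := cgenP b => hb ha.
  rewrite (@gen_perm_block a b c) ?(@gen_perm_block c a a) 1?addbC // => m;
  by rewrite /flip ?lc ?hc; case: ifP; lia.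
Qed.

Definition odd_flips (s : J n) S : bool := qlift (word_odd_flips ^~ S) s.

Lemma odd_flipsE w S : odd_flips (cword w) S = word_odd_flips w S.
Proof.
apply: (J_eq_ind (f := word_odd_flips ^~ S)) => p q l r h.
rewrite !word_odd_flips_cat (word_odd_flips_relator _ h).
by rewrite (word_perm_relator h).
Qed.

(** The cocycle rule, that is, multiplicativity of the map to the semidirect
    product of (Z/2)^{subsets} and the symmetric group. *)
Lemma odd_flipsM s t S :
  odd_flips (s * t) S = odd_flips s S (+) odd_flips t (cactus_perm s @: S).
Proof.
elim/J_ind: s => u; elim/J_ind: t => v.
by rewrite -cwordM !odd_flipsE cactus_permE word_odd_flips_cat.
Qed.

Lemma odd_flips1 S : odd_flips 1 S = false.
Proof. exact: (odd_flipsE [::]). Qed.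

End OddFlips.

(** * Parities and cloning *)

Section Clone.
Variable n : nat.
Implicit Types (p : 'I_n) (a : cgen n) (w : seq (cgen n)) (S : {set 'I_n}).

(** The map that merges the two copies [wid p] and [lift (wid p) p] of the
    strand p; [unlift] fails on [wid p], whence the default value p. *)
Definition collapse p (m : 'I_n.+1) : 'I_n := odflt p (unlift (wid p) m).

Lemma collapse_lift p (m : 'I_n) : collapse p (lift (wid p) m) = m.
Proof. by rewrite /collapse liftK. Qed.

Lemma val_collapse p (m : 'I_n.+1) :
  collapse p m = (if m <= p then m : nat else m.-1) :> nat.
Proof.
rewrite /collapse; case: unliftP => [k ->|->] /=; last by rewrite leqnn.
by rewrite /bump; case: leqP; case: leqP; lia.
Qed.

Lemma collapse_clone p (s : 'S_n) m :
  collapse (s p) (lift_perm (wid p) (wid (s p)) s m) = s (collapse p m).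
Proof.
case: (unliftP (wid p) m) => [k ->|->].
  by rewrite lift_perm_lift !collapse_lift.
by rewrite lift_perm_id /collapse !unlift_none.
Qed.

Definition double p S : {set 'I_n.+1} := collapse p @^-1: S.

Lemma double_inj p : injective (double p).
Proof.
move=> S S' /setP h; apply/setP => m.
by have := h (lift (wid p) m); rewrite !inE collapse_lift.
Qed.

Lemma card_double p S : #|S| <= #|double p S|.
Proof.
rewrite -(card_imset _ (@lift_inj _ (wid p))); apply: subset_leq_card.
by apply/subsetP => _ /imsetP[m mS ->]; rewrite inE collapse_lift.
Qed.

Lemma perm_double p (s : 'S_n) S :
  lift_perm (wid p) (wid (s p)) s @: double p S = double (s p) (s @: S).
Proof.
apply/setP => m; set f := lift_perm _ _ _.
rewrite -[m](permKV f); set k := f^-1 m.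
rewrite mem_imset; last exact: perm_inj.
by rewrite !inE collapse_clone mem_imset //; apply: perm_inj.
Qed.

Lemma double_block p a (b : cgen n.+1) :
  (forall m : 'I_n.+1, (lo b <= m <= hi b) =
     (lo a <= (if m <= p then m : nat else m.-1) <= hi a)) ->
  forall S, (double p S == block b) = (S == block a).
Proof.
move=> h S; rewrite -(inj_eq (@double_inj p)); congr (_ == _).
by apply/setP => m; rewrite !inE h val_collapse.
Qed.

(** If p lies in the interval of a, its clone has the extra letter
    s_{p,p+1}. That letter does not move a doubled set, and it flips only the
    double of {p}: this is why S needs a second element. The last letter of the
    clone has as interval the double of that of a. *)
Lemma word_odd_flips_gen_clone p a S : 1 < #|S| ->
  word_odd_flips (gen_clone p a) (double p S) = (S == block a).
Proof.
move=> cS; rewrite /gen_clone; have := cgenP a => ha.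
case: ifP => [ap|pa].
  rewrite /= addbF; apply: double_block => m.
  rewrite -[lo (gen_keep a)]/(lo a) -[hi (gen_keep a)]/(hi a).
  by case: ifP; lia.
case: ifP => [pa'|ap].
  rewrite /= addbF; apply: double_block => m.
  rewrite -[lo (gen_shift a)]/(lo a).+1 -[hi (gen_shift a)]/(hi a).+1.
  by case: ifP; lia.
rewrite /= addbF.
have -> : gen_perm (gen_split p) @: double p S = double p S.
  apply/setP => m; rewrite mem_gen_perm !inE.
  suff -> : collapse p (gen_perm (gen_split p) m) = collapse p m by [].
  apply: ord_inj; rewrite !val_collapse gen_permE /flip.
  rewrite -[lo _]/(p : nat) -[hi _]/p.+1.
  by do !case: ifP; lia.
have -> : (double p S == block (gen_split p)) = false.
  apply/negbTE/eqP => e; have : S \subset [set p].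
    apply/subsetP => m mS; rewrite inE -val_eqE /=.
    have : lift (wid p) m \in block (gen_split p).
      by rewrite -e inE collapse_lift.
    rewrite inE -[lo _]/(p : nat) -[hi _]/p.+1 /= /bump.
    by case: leqP; lia.
  by move/subset_leq_card; rewrite cards1; lia.
apply: double_block => m.
rewrite -[lo (gen_grow a)]/(lo a) -[hi (gen_grow a)]/(hi a).+1.
by case: ifP; lia.
Qed.

Lemma word_perm_gen_clone p a :
  word_perm (gen_clone p a) =
    lift_perm (wid p) (wid (gen_perm a p)) (gen_perm a).
Proof.
have := word_clone_perm p [:: a]; rewrite /= cats0 => ->.
by rewrite /word_perm big_seq1.
Qed.

Lemma odd_flips_clone p (s : J n) S : 1 < #|S| ->
  odd_flips (cactus_clone p s) (double p S) = odd_flips s S.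
Proof.
elim/J_ind: s => w; rewrite cactus_cloneE !odd_flipsE.
elim: w p S => //= a w ih p S cS.
rewrite word_odd_flips_cat word_odd_flips_gen_clone //.
rewrite word_perm_gen_clone perm_double.
by rewrite ih // card_imset //; apply: perm_inj.
Qed.

Definition splits p (S : {set 'I_n.+1}) :=
  (wid p \in S) != (lift (wid p) p \in S).

(** The interval of a letter of a clone contains both copies of p or neither,
    even that of s_{p,p+1}, which moreover only exchanges the copies. *)
Lemma word_odd_flips_gen_clone_split p a (S : {set 'I_n.+1}) : splits p S ->
  word_odd_flips (gen_clone p a) S = false.
Proof.
have hb (b : cgen n.+1) A : splits p A ->
    (lo b <= p <= hi b) = (lo b <= p.+1 <= hi b) -> (A == block b) = false.
  move=> sA h; apply/negbTE; apply: contraNneq sA => ->.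
  by rewrite !inE /= /bump leqnn add1n h.
move=> sS; rewrite /gen_clone; have := cgenP a => ha.
case: ifP => [ap|pa]; last case: ifP => [pa'|ap]; rewrite /= addbF.
- by apply: hb => //; rewrite -[hi (gen_keep a)]/(hi a); lia.
- by apply: hb => //; rewrite -[lo (gen_shift a)]/(lo a).+1; lia.
rewrite (hb (gen_split p)) ?(hb (gen_grow a)) //.
- have swap : gen_perm (gen_split p) (wid p) = lift (wid p) p.
    apply: ord_inj; rewrite gen_permE /flip /gen_split /lo /hi /= /bump leqnn.
    by case: ifP; lia.
  by move: sS; rewrite /splits !mem_gen_perm -swap gen_permK swap eq_sym.
- by rewrite -[lo (gen_grow a)]/(lo a) -[hi (gen_grow a)]/(hi a).+1; lia.
- by rewrite -[lo (gen_split p)]/(p : nat) -[hi _]/p.+1; lia.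
Qed.

Lemma odd_flips_clone_split p (s : J n) (S : {set 'I_n.+1}) : splits p S ->
  odd_flips (cactus_clone p s) S = false.
Proof.
elim/J_ind: s => w; rewrite cactus_cloneE odd_flipsE.
elim: w p S => //= a w ih p S sS.
rewrite word_odd_flips_cat word_odd_flips_gen_clone_split //= ih //.
rewrite word_perm_gen_clone.
set f := lift_perm _ _ _.
have e1 : wid (gen_perm a p) = f (wid p) by rewrite lift_perm_id.
have e2 : lift (wid (gen_perm a p)) (gen_perm a p) = f (lift (wid p) p).
  by rewrite lift_perm_lift.
by rewrite /splits e2 e1 !mem_imset //; apply: perm_inj.
Qed.

End Clone.

(** * A pure element that flips two strands an odd number of times *)

Section PureElement.
Variable n : nat.

Definition pos_pair i j : {set 'I_n} :=
  [set m : 'I_n | (m == i :> nat) || (m == j :> nat)].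

Lemma gen_perm_pos_pair (a : cgen n) i j : i < n -> j < n ->
  gen_perm a @: pos_pair i j = pos_pair (flip a i) (flip a j).
Proof.
move=> hi hj; apply/setP => m; rewrite mem_gen_perm !inE.
rewrite -[i]/(val (Ordinal hi)) -[j]/(val (Ordinal hj)) -!gen_permE !val_eqE.
by rewrite -!(inj_eq (@perm_inj _ (gen_perm a)) m) !gen_permK.
Qed.

(** The element is (s_{0,2} s_{0,1})^3, with strands numbered from 0. Its
    permutation is the cube of a 3-cycle. The strands {1,2} occupy the interval
    of a letter only at the first s_{0,1}, after the first s_{0,2} has brought
    them to {0,1}. *)
Lemma exists_pure_odd_flips : 2 < n ->
  exists2 s : J n, cactus_perm s = 1 & odd_flips s (pos_pair 1%N 2).
Proof.
move=> n_gt2; have h02 : 0 < 2 < n by [].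
have h01 : 0 < 1%N < n by lia.
set a : cgen n := exist _ (0, 2) h02; set b : cgen n := exist _ (0, 1%N) h01.
have fa i : flip a i = if i <= 2 then 2 - i else i by [].
have fb i : flip b i = if i <= 1%N then 1%N - i else i by [].
exists (cword [:: a; b; a; b; a; b]).
  rewrite cactus_permE; apply/permP => m; apply: ord_inj.
  rewrite !word_permE !gen_permE !fa !fb.
  by case: (val m) => [|[|[|k]]].
have neq k c i j : k < n -> ((k == i) || (k == j)) != (lo c <= k <= hi c) ->
    (pos_pair i j == block c) = false.
  move=> hk h; apply/negbTE; apply: contraNneq h => /setP/(_ (Ordinal hk)).
  by rewrite !inE => ->.
have eq10 : pos_pair 1%N 0 = block b.
  by apply/setP => m; rewrite !inE -[lo b]/0 -[hi b]/1%N; lia.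
rewrite odd_flipsE /= !gen_perm_pos_pair ?fa ?fb //=; try lia.
rewrite !(subnn, subSS, subn0).
(* The strands {1,2} occupy {1,2}, {1,0}, {0,1}, {2,1}, {2,0}, {0,2} in turn;
   each call of [neq] names a position that tells the pair from the interval. *)
rewrite (neq 0) //; last lia.
rewrite eq10 eqxx (neq 2) // (neq 2) // (neq 1%N) ?(neq 2) //; lia.
Qed.

End PureElement.

(** * Pure tree pairs *)

Section Pure.
Variable D : cloning.

Definition pure_pair (x : tree_pair D) : Prop :=
  domt x = codt x /\ to_perm (elt x) = 1.

Lemma pure_expansion x y : expansion x y -> pure_pair x -> pure_pair y.
Proof.
move=> [i ->] [h p]; split; rewrite /= ?p ?perm1 ?h //.
by rewrite clone_perm p perm1 lift_perm1.
Qed.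

Lemma pure_exps x y : x ~~> y -> pure_pair x -> pure_pair y.
Proof. by elim=> // u v w /pure_expansion uv _ ih /uv. Qed.

(** A pair with trivial class has a common expansion with the one-leaf identity
    pair, and all expansions of the latter are of the form (T, 1, T). *)
Lemma tclass_eq1 (x : tree_pair D) : tclass x = 1 ->
  exists y, [/\ x ~~> y, pure_pair y & elt y = 1].
Proof.
move=> /tclassP /equiv_exps [y xy ly]; exists y; split=> //.
  by apply: pure_exps ly _; split; rewrite ?to_perm1.
by elim: ly (erefl : elt (TreePair leaf (1 : D 1%N) leaf) = 1) =>
  // u v w [i ->] _ ih e; apply: ih; rewrite /= e clone1.
Qed.

End Pure.

Lemma exps_perm_pair (E : cloning) (x : tree_pair E) y :
  perm_pair x ~~> y -> exists2 z, x ~~> z & perm_pair z = y.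
Proof.
move e : (perm_pair x) => u h.
elim: h x e => {u y} [u x <-|u v w [i ->] _ ih x e].
  by exists x => //; apply: rt1n_refl.
subst u; have [|z hz <-] := ih (@expand E x i).
  by rewrite /perm_pair /expand /= clone_perm.
by exists z => //; apply: rt1n_trans hz; exists i.
Qed.

(** A trivial image in V becomes visible after an expansion of the image pair,
    and that expansion can be performed on the pair itself. *)
Lemma pibar1_pure (E : cloning) (X : thompson E) :
  pibar X = 1 <-> exists2 x, pure_pair x & X = tclass x.
Proof.
split.
  elim/tclass_ind: X => x; rewrite pibarE => /tclass_eq1[y [xy py _]].
  have [z xz e] := exps_perm_pair xy; exists z.
    by move: py; rewrite -e; case.
  by rewrite (exps_tclass xz).
move=> [[n A s B] [/= -> p] ->].
by rewrite pibarE /perm_pair /= p [LHS](@toneE perm_cloning).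
Qed.

(** * Finitely many pure classes over one tree *)

Lemma subtree_trans (T1 T2 T3 : tree) :
  subtree T1 T2 -> subtree T2 T3 -> subtree T1 T3.
Proof.
elim: T1 T2 T3 => // l hl r hr [|l2 r2] [|l3 r3] //= /andP[a b] /andP[c d].
by rewrite (hl _ _ a c) (hr _ _ b d).
Qed.

Section SingleTree.
Variable E : cloning.

(** The tree is not indexed by its number of leaves, so that representatives
    of different sizes are compared without transport. *)
Definition pure_over (T : tree) (X : thompson E) : Prop :=
  exists x : tree_pair E, [/\ pure_pair x, val (domt x) = T & X = tclass x].

Lemma pure_over_sub T T' X : subtree T T' -> pure_over T X -> pure_over T' X.
Proof.
move=> TT' [x [px eT ->]]; rewrite -eT in TT'.
have [y xy <-] := exps_dom TT'.
by exists y; split=> //; [apply: pure_exps xy px|rewrite (exps_tclass xy)].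
Qed.

Lemma pure_over1 T : pure_over T 1.
Proof.
pose A : ntree (leaves T) := exist _ T (eqxx _).
exists (TreePair A 1 A).
by split=> //; [split; rewrite ?to_perm1|rewrite toneE].
Qed.

Lemma pure_overV T X : pure_over T X -> pure_over T X^-1.
Proof.
move=> [x [[h p] <- ->]]; exists (tinv x); split; last exact: tinvqE.
  by split; rewrite /= ?h // to_permV p invg1.
by rewrite /= h.
Qed.

Lemma pure_overM T X Y : pure_over T X -> pure_over T Y -> pure_over T (X * Y).
Proof.
move=> [x [[hx px] Tx ->]] [y [[hy py] Ty ->]].
have [|z xyz] := @tcomp_ex _ x y; first by rewrite -hx Tx Ty.
exists z; rewrite -(tcomp_mul xyz).
case: xyz hx px Tx hy py Ty => n [A [B [C [s [t [-> -> ->]]]]]] /=.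
move=> -> p -> -> q _.
by split=> //; split; rewrite /= ?to_permM ?p ?q ?mulg1.
Qed.

Lemma generated_pure_over (S : seq (thompson E)) T :
  (forall X, X \in S -> pure_over T X) ->
  forall X, generated S X -> pure_over T X.
Proof.
move=> hS X; elim=> [Y /hS //||Y Z _ hY _ hZ|Y _ hY].
- exact: pure_over1.
- exact: pure_overM.
- exact: pure_overV.
Qed.

(** The tree T is a lower bound, which serves to ensure a minimal number of
    leaves. *)
Lemma pure_over_seq T (S : seq (thompson E)) :
  (forall X, X \in S -> pibar X = 1) ->
  exists2 T', subtree T T' & forall X, X \in S -> pure_over T' X.
Proof.
elim: S => [|X S ih] hS; first by exists T; rewrite ?subtree_refl.
have [Y YS|T1 TT1 h1] := ih; first by apply: hS; rewrite inE YS orbT.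
have [x px eX] : exists2 x, pure_pair x & X = tclass x.
  by apply/pibar1_pure/hS; rewrite mem_head.
exists (jointree T1 (val (domt x))).
  exact: subtree_trans TT1 (subtree_joinl _ _).
move=> Y; rewrite inE => /predU1P[->|/h1 hY].
  by apply: pure_over_sub (subtree_joinr _ _) _; exists x.
exact: pure_over_sub (subtree_joinl _ _) hY.
Qed.

End SingleTree.

(** * No tree supports all pure classes *)

(** A witness of nontriviality that expansions preserve; the bound on the size
    is what [odd_flips_clone] asks for. *)
Definition nontrivially_flips (x : tree_pair cactus_cloning) : Prop :=
  exists2 S : {set 'I_(npair x)}, 1 < #|S| & odd_flips (elt x : J _) S.

Lemma nontrivially_flips_exps x y :
  x ~~> y -> nontrivially_flips x -> nontrivially_flips y.
Proof.
elim=> // u v w [i ->] _ ih [S cS hS]; apply: ih.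
exists (double i S); first exact: leq_trans cS (card_double _ _).
exact: etrans (odd_flips_clone i _ cS) hS.
Qed.

Lemma nontrivially_flips_neq1 x : nontrivially_flips x -> tclass x <> 1.
Proof.
move=> hx /tclass_eq1[y [/nontrivially_flips_exps/(_ hx)[S _ hS] _ e]].
rewrite e in hS; exact: notF (etrans (esym (odd_flips1 S)) hS).
Qed.

(** If the class were also that of a pure pair (T, t, T), it would be that of
    (T', t', T') with t' the clone of t at i and T' = [caret T i]. On S, which
    separates the copies of i, the parity of t' is 0, so that s t'^-1 has the
    parity of s; but (T', s t'^-1, T') has trivial class. *)
Lemma not_pure_over_caret n (T : ntree n) (i : 'I_n) (s : J n.+1)
    (S : {set 'I_n.+1}) :
  cactus_perm s = 1 -> 1 < #|S| -> odd_flips s S -> splits i S ->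
  ~ pure_over (val T)
      (tclass (@TreePair cactus_cloning _ (caret T i) s (caret T i))).
Proof.
move=> ps cS hS sS [[m A t B] [[/= eAB pt] AT]].
have e := ntree_size AT; subst m; subst B; move/val_inj: AT => AT; subst A.
have -> : tclass (@TreePair cactus_cloning _ T t T) =
    tclass (@TreePair cactus_cloning _
              (caret T i) (cactus_clone i t) (caret T i)).
  by apply/esym/exps_tclass/exps1; exists i; rewrite /expand /= pt perm1.
set t' := cactus_clone i t => e.
suff : tclass (@TreePair cactus_cloning _
                 (caret T i) (s * t'^-1) (caret T i)) = 1.
  apply: nontrivially_flips_neq1; exists S => //=.
  rewrite odd_flipsM hS ps imset_perm1.
  have <- : cactus_clone i (t^-1) = t'^-1.
    by rewrite -[RHS](@cloneV cactus_cloning) /= pt perm1.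
  by rewrite odd_flips_clone_split.
by rewrite -(tmulE _ (caret T i)) e tmulE mulgV toneE.
Qed.

Theorem proposition3p4 : ~ finitely_generated PCV.
Proof.
move=> [Sgen hS].
have PCVE X : X \in PCV <-> pibar X = 1 by rewrite inE; split=> /eqP.
have [X /(generated_mem)/hS/PCVE //|T0 sub h] :=
  @pure_over_seq cactus_cloning (Node Leaf Leaf) Sgen.
have : 1 < leaves T0 := subtree_leaves sub.
have over X : X \in PCV -> pure_over T0 X.
  by move=> /hS; apply: generated_pure_over.
pose T : ntree (leaves T0) := exist _ T0 (eqxx _).
move: (leaves T0) T (erefl T0 : val T = T0) => n T eT n_gt1.
pose i : 'I_n := Ordinal (ltnW n_gt1).
have [s ps hs] := exists_pure_odd_flips (n_gt1 : 2 < n.+1).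
apply: (@not_pure_over_caret n T i s (pos_pair n.+1 1%N 2)) => //.
- apply/card_gt1P.
  exists (Ordinal (ltnW n_gt1 : 1%N < n.+1)), (Ordinal (n_gt1 : 2 < n.+1)).
  by rewrite !inE.
- by rewrite /splits !inE.
rewrite eT; apply/over/PCVE/pibar1_pure.
by exists (@TreePair cactus_cloning _ (caret T i) s (caret T i)).
Qed.
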